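(* For each integer $n \geq 1$, there is a wRK-complete $\mathbf{\Sigma}^1_n$ ideal on $\omega$; that is, there is a $\mathbf{\Sigma}^1_n$ ideal $\mathcal J$ on $\omega$ such that $\mathcal I \leq_{\rm wRK} \mathcal J$ for every $\mathbf{\Sigma}^1_n$ ideal $\mathcal I$ on $\omega$.
   Context: The power set $\mathcal P(\omega)$ is identified with the Cantor space $2^\omega$ via characteristic functions. An ideal on $\omega$ is a nonempty family $\mathcal I$ of subsets of $\omega$ such that for all $x,y\subseteq\omega$: $x,y\in\mathcal I \implies x\cup y\in\mathcal I$, and $y\subseteq x\in\mathcal I \implies y\in\mathcal I$. (An ideal need not contain all finite sets and may equal $2^\omega$.) An ideal is called $\mathbf{\Sigma}^1_n$ if it is a (boldface) $\mathbf{\Sigma}^1_n$ subset of $2^\omega$. For ideals $\mathcal I,\mathcal J$ on $\omega$, $\mathcal I\leq_{\rm wRK}\mathcal J$ (weak Rudin-Keisler reducibility) means that there are an infinite set $A\subseteq\omega$ and a function $f:A\to\omega$ such that for each $x\subseteq\omega$, $x\in\mathcal I \iff f^{-1}[x]\in\mathcal J$, where $f^{-1}[x]=\{a\in A: f(a)\in x\}$. If $\mathcal C$ is a family of ideals and $\mathcal J\in\mathcal C$ satisfies $\mathcal I\leq_{\rm wRK}\mathcal J$ for each $\mathcal I\in\mathcal C$, then $\mathcal J$ is called a wRK-complete $\mathcal C$ ideal. *)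

(* Defs.v *)
From HB Require Import structures.
From mathcomp Require Import all_boot all_classical.
From mathcomp Require Export topology cantor.

Set Implicit Arguments.
Unset Strict Implicit.
Unset Printing Implicit Defensive.

Local Open Scope classical_set_scope.

Definition baire_space : Type := prod_topology (fun _ : nat => nat).

HB.instance Definition _ := Topological.on baire_space.

(** [Sigma1 n A]: [A] is a boldface Sigma^1_n subset of [X], for [n >= 1].
    Sigma^1_1 sets are the projections along the Baire space of closed sets,
    and Sigma^1_(n+1) sets are the projections along the Baire space of
    Pi^1_n sets, i.e. of complements of Sigma^1_n sets.  This is meant for
    Polish [X]; starting from the Cantor space, the recursion only goes through
    products of it with finitely many copies of the Baire space.  The hierarchy
    has no level 0, so [Sigma1 0] is empty. *)
Fixpoint Sigma1 (n : nat) (X : topologicalType) (A : set X) {struct n} : Prop :=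
  match n with
  | 0 => False
  | m.+1 =>
    match m with
    | 0 => exists2 C : set (X * baire_space)%type, closed C & A = fst @` C
    | _.+1 => exists2 B : set (X * baire_space)%type,
                Sigma1 m (~` B) & A = fst @` B
    end
  end.

Definition is_ideal (I : set (set nat)) : Prop :=
  [/\ I !=set0,
      (forall x y, I x -> I y -> I (x `|` y)) &
      (forall x y, y `<=` x -> I x -> I y)].

(** The family [I] seen in the Cantor space through characteristic functions. *)
Definition char_family (I : set (set nat)) : set cantor_space :=
  [set c : cantor_space | I [set i : nat | c i]].

Definition Sigma1_ideals (n : nat) : set (set (set nat)) :=
  [set I | is_ideal I /\ Sigma1 n (char_family I)].

(** [set_val @` (f @^-1` x)] is f^-1[x] regarded as a subset of nat rather than
    of the subtype attached to [A]. *)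
Definition wRK_le (I J : set (set nat)) : Prop :=
  exists (A : set nat) (f : A -> nat), infinite_set A /\
    forall x : set nat, I x <-> J (set_val @` (f @^-1` x)).

Definition wRK_complete (C : set (set (set nat))) (J : set (set nat)) : Prop :=
  C J /\ forall I, C I -> wRK_le I J.

(* Main.v *)
(** Let [U] be a universal Sigma^1_n subset of the Cantor space, with sections
    [U_g] indexed by the Baire space.  For a branch [g], let [A_g] be the set of
    pairs [(s, m)] with [s] a finite prefix of [g], and copy a set [x] of
    numbers to the set of the [(s, m)] in [A_g] with [m] in [x].  Let [J] be the
    ideal generated by the copies along [g] of the members of [U_g], for all
    [g] at once; it is Sigma^1_n by closure under projections and countable
    intersections.  Prefixes separate a branch from finitely many others, and
    each number is repeated along all the prefixes of [g], so the copies along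
    other branches do not help to cover a copy along [g] (this matters because
    ideals need not contain the finite sets).  Hence, if [U_g] is an ideal, the
    projection of [A_g] to the second coordinate reduces it to [J]. *)

Require Import Defs.
From mathcomp Require Import all_boot all_classical.
(* Required again since [all_boot] shadows the topological [closed]. *)
From mathcomp Require Import topology cantor.

Set Implicit Arguments.
Unset Strict Implicit.
Unset Printing Implicit Defensive.

Local Open Scope classical_set_scope.

(** * Continuity of maps into and out of products *)

Lemma product_continuous (X : topologicalType) (K : nat -> topologicalType)
    (f : X -> prod_topology K) :
  (forall i, continuous (fun x => f x i)) -> continuous f.
Proof.
move=> fcont x; apply/cvg_sup => i U nU; change (nbhs x (f @^-1` U)).
move: nU; rewrite {1}nbhsE => -[_ [[B oB <-] /= Bfx] sBU].
have h := (fcont i x B (open_nbhs_nbhs (conj oB Bfx))).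
by apply: (@filterS _ (nbhs x) _ (fun y => B (f y i))) h => y By; exact: sBU.
Qed.

Lemma coord_continuous (K : nat -> topologicalType) i :
  continuous (fun f : prod_topology K => f i).
Proof. exact: proj_continuous. Qed.

Lemma pair_continuous (X Y Z : topologicalType) (f : X -> Y) (g : X -> Z) :
  continuous f -> continuous g -> continuous (fun x => (f x, g x)).
Proof. by move=> fc gc x; apply: cvg_pair; [exact: fc | exact: gc]. Qed.

Lemma comp_continuous (X Y Z : topologicalType) (f : X -> Y) (g : Y -> Z) :
  continuous f -> continuous g -> continuous (fun x => g (f x)).
Proof. by move=> fc gc x; apply: continuous_comp; [exact: fc | exact: gc]. Qed.

Lemma fst_continuous (X Y : topologicalType) : continuous (@fst X Y).
Proof. by move=> x; exact: cvg_fst. Qed.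

Lemma snd_continuous (X Y : topologicalType) : continuous (@snd X Y).
Proof. by move=> x; exact: cvg_snd. Qed.

(** * Locally constant maps *)

(** This is continuity into a discrete space, phrased without a topology on [T], so that conditions
    on finitely many digits can be built up by ordinary operations. *)
Definition locally_constant (X : topologicalType) (T : Type) (h : X -> T) :=
  forall x, \forall y \near x, h y = h x.

Section LocallyConstant.
Context {X : topologicalType}.

Lemma locally_constant_open T (h : X -> T) (P : set T) :
  locally_constant h -> open (h @^-1` P).
Proof.
by move=> hc; rewrite openE => x Px; apply: filterS (hc x) => y /= ->.
Qed.

Lemma locally_constant_closed T (h : X -> T) (P : set T) :
  locally_constant h -> closed (h @^-1` P).
Proof.
move=> hc; rewrite -[_ @^-1` _]setCK closedC.
exact: (@locally_constant_open _ _ (~` P)).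
Qed.

Lemma locally_constant_cst T (c : T) : locally_constant (fun _ : X => c).
Proof. by move=> x; exact: nearW. Qed.

Lemma locally_constant_op T S V (F : T -> S -> V) (f : X -> T) (g : X -> S) :
  locally_constant f -> locally_constant g ->
  locally_constant (fun x => F (f x) (g x)).
Proof.
by move=> fc gc x; apply: filterS2 (fc x) (gc x) => y -> ->.
Qed.

Lemma locally_constant_select T S (h : X -> T) (f : T -> X -> S) :
  locally_constant h -> (forall i, locally_constant (f i)) ->
  locally_constant (fun x => f (h x) x).
Proof.
by move=> hc fc x; apply: filterS2 (hc x) (fc (h x) x) => y ->.
Qed.

Lemma locally_constant_mkseq T (f : nat -> X -> T) n :
  (forall i, locally_constant (f i)) ->
  locally_constant (fun x => mkseq (f^~ x) n).
Proof.
move=> fc; elim: n => [|n IH]; first exact: locally_constant_cst.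
move=> x; apply: filterS2 (IH x) (fc n x) => y e1 e2.
by rewrite !mkseqS e1 e2.
Qed.

Lemma locally_constant_coord (T : discreteTopologicalType)
    (f : X -> prod_topology (fun _ : nat => T)) i :
  continuous f -> locally_constant (fun x => f x i).
Proof.
move=> fc x; have c := comp_continuous fc (@coord_continuous (fun _ => T) i).
exact: (c x _ (discrete_set1 _)).
Qed.

Lemma locally_constant_continuous (T : topologicalType) (h : X -> T) :
  locally_constant h -> continuous h.
Proof.
move=> hc x U /nbhs_singleton Uhx.
by apply: (@filterS _ (nbhs x) _ [set y | h y = h x]) (hc x) => y /= ->.
Qed.

End LocallyConstant.

Lemma locally_constant_comp (X Y : topologicalType) T
    (f : X -> Y) (h : Y -> T) :
  continuous f -> locally_constant h -> locally_constant (fun x => h (f x)).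
Proof. by move=> fc hc x; exact: (fc x _ (hc (f x))). Qed.

(** * Closure properties of the projective classes *)

(** One point of the Baire space codes a sequence of points. The value 0 of [unslice] off the codes
    of pairs is never read by a slice. *)
Definition slice (i : nat) (e : baire_space) : baire_space :=
  fun m => e (pickle (i, m)).

Definition unslice (g : nat -> baire_space) : baire_space :=
  fun a => if @unpickle (nat * nat)%type a is Some (i, m) then g i m else 0.

Lemma slice_unslice g i : slice i (unslice g) = g i.
Proof. by apply/funext => m; rewrite /slice /unslice pickleK. Qed.

Lemma slice_continuous i : continuous (slice i).
Proof. by apply: product_continuous => m; exact: coord_continuous. Qed.

(** Pulling back along [f] times the identity commutes with projection and with complement, so the
    induction climbs the hierarchy. *)
Lemma Sigma1_preimage n (X Y : topologicalType) (f : X -> Y) (A : set Y) :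
  continuous f -> Sigma1 n A -> Sigma1 n (f @^-1` A).
Proof.
elim: n X Y f A => [//|n IH] X Y f A fc.
have gc : continuous (fun p : X * baire_space => (f p.1, p.2)).
  apply: pair_continuous; last exact: snd_continuous.
  exact: (comp_continuous (@fst_continuous _ _)).
have E (B : set (Y * baire_space)) : A = fst @` B ->
    f @^-1` A = fst @` ((fun p : X * baire_space => (f p.1, p.2)) @^-1` B).
  move=> ->; apply/seteqP; split=> x /=.
    by move=> [[y g] Byg /= yE]; exists (x, g) => //=; rewrite -yE.
  by move=> [[x' g] /= B' <-]; exists (f x', g).
case: n IH => [_|n IH] [B BS /E ->]; eexists; try reflexivity.
  by move/continuous_closedP : gc; exact.
by rewrite preimage_setC; exact: IH BS.
Qed.

(** Two successive witnesses are merged into one, as its slices 0 and 1. *)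
Lemma Sigma1_proj n (X : topologicalType) (A : set (X * baire_space)) :
  Sigma1 n A -> Sigma1 n (fst @` A).
Proof.
pose f (p : X * baire_space) := ((p.1, slice 0 p.2), slice 1 p.2).
have fc : continuous f.
  apply: pair_continuous; last first.
    exact: (comp_continuous (@snd_continuous _ _) (@slice_continuous _)).
  apply: pair_continuous; first exact: fst_continuous.
  exact: (comp_continuous (@snd_continuous _ _) (@slice_continuous _)).
have E (B : set ((X * baire_space) * baire_space)) : A = fst @` B ->
    fst @` A = fst @` (f @^-1` B).
  move=> ->; apply/seteqP; split=> x /=.
    move=> [_ [[[x' g] h] Bp <-] /= <-].
    exists (x', unslice (fun i => if i is 0 then g else h)) => //=.
    by rewrite /f /= !slice_unslice.
  by move=> [[x' g] Bp /= <-]; exists (x', slice 0 g) => //; exists (f (x', g)).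
case: n => [//|[|n]] [B BS /E ->]; eexists; try reflexivity.
  by move/continuous_closedP : fc; exact.
by rewrite preimage_setC; exact: (@Sigma1_preimage n.+1 _ _ f _ fc BS).
Qed.

(** The set is the projection of its cylinder, and the complement of the cylinder is again a
    preimage under a locally constant map. *)
Lemma Sigma1_clopen n (X : topologicalType) T (h : X -> T) (P : set T) :
  locally_constant h -> Sigma1 n.+1 (h @^-1` P).
Proof.
elim: n X h P => [|n IH] X h P hc.
all: have hc' : locally_constant (fun p : X * baire_space => h p.1)
  by exact: (locally_constant_comp (@fst_continuous _ _)).
all: have E : h @^-1` P = fst @` ((fun p : X * baire_space => h p.1) @^-1` P)
  by apply/seteqP; split=> x /= => [Px|[[? ?] /= ? <-]];
    first exists (x, fun=> 0).
  by eexists; [|exact: E]; exact: locally_constant_closed.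
by eexists; [|exact: E]; rewrite preimage_setC; exact: IH.
Qed.

(** Selecting by a locally constant index commutes with complements, which a union does not; this
    lets the induction pass from one level to the next. Countable unions are then derived from
    it. *)
Lemma Sigma1_select n (X : topologicalType) (h : X -> nat) (A : nat -> set X) :
  locally_constant h -> (forall i, Sigma1 n (A i)) ->
  Sigma1 n [set x | A (h x) x].
Proof.
elim: n X h A => [|n IH] X h A hc; first by move=> /(_ 0).
have hc' : locally_constant (fun p : X * baire_space => h p.1).
  exact: (locally_constant_comp (@fst_continuous _ _)).
have E (B : nat -> set (X * baire_space)) : (forall i, A i = fst @` B i) ->
    [set x | A (h x) x] = fst @` [set p | B (h p.1) p].
  move=> AE; apply/seteqP; split=> x /=; rewrite ?AE.
    by move=> [[x' g] + /= e]; rewrite -e => Bp; exists (x', g).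
  by move=> [[x' g] /= Bp <-]; exists (x', g).
case: n IH => [_|n IH] AS.
  have BE : forall i, exists B : set (X * baire_space),
      closed B /\ A i = fst @` B.
    by move=> i; have [B] := AS i; exists B.
  have [B BP] := choice BE.
  eexists; last by apply: E => i; exact: (BP i).2.
  rewrite (_ : [set _ | _] =
    \bigcap_i ((fun p => h p.1) @^-1` [set~ i] `|` B i)).
    apply: closed_bigI => i _; apply: closedU; last exact: (BP i).1.
    exact: locally_constant_closed.
  apply/seteqP; split=> p /=.
    by move=> Bp i _; have [<-|/eqP] := eqVneq (h p.1) i; [right|left].
  by move=> /(_ (h p.1) I) [/(_ erefl)|].
have BE : forall i, exists B : set (X * baire_space),
    Sigma1 n.+1 (~` B) /\ A i = fst @` B.
  by move=> i; have [B] := AS i; exists B.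
have [B BP] := choice BE.
exists [set p | B (h p.1) p]; last by apply: E => i; exact: (BP i).2.
exact: (IH _ (fun p => h p.1) (fun i => ~` B i) hc' (fun i => (BP i).1)).
Qed.

(** The index is stored as the first entry of a witness and projected away. *)
Lemma Sigma1_bigcup n (X : topologicalType) (A : nat -> set X) :
  (forall i, Sigma1 n (A i)) -> Sigma1 n (\bigcup_i A i).
Proof.
move=> AS; rewrite (_ : \bigcup_i A i =
    fst @` [set p : X * baire_space | A (p.2 0) p.1]).
  apply: Sigma1_proj.
  apply: (@Sigma1_select _ _ (fun p : X * baire_space => p.2 0)
            (fun i => fst @^-1` A i)).
    exact: (@locally_constant_coord _ nat _ 0 (@snd_continuous _ _)).
  by move=> i; exact: Sigma1_preimage (@fst_continuous _ _) (AS i).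
apply/seteqP; split=> x /=.
  by move=> [i _ Ax]; exists (x, fun=> i).
by move=> [[x' g] /= Ax <-]; exists (g 0).
Qed.

(** Countable choice gives a witness for each [i], and a single point codes them all. Above the
    first level, the complement of the resulting intersection is a countable union one level
    down. *)
Lemma Sigma1_bigcap n (X : topologicalType) (A : nat -> set X) :
  (forall i, Sigma1 n (A i)) -> Sigma1 n (\bigcap_i A i).
Proof.
pose f i (p : X * baire_space) := (p.1, slice i p.2).
have fc i : continuous (f i).
  apply: pair_continuous; first exact: fst_continuous.
  exact: (comp_continuous (@snd_continuous _ _) (@slice_continuous _)).
have E (B : nat -> set (X * baire_space)) : (forall i, A i = fst @` B i) ->
    \bigcap_i A i = fst @` (\bigcap_i f i @^-1` B i).
  move=> AE; apply/seteqP; split=> x /=.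
    move=> Ax; have gE : forall i, exists g, B i (x, g).
      move=> i; have := Ax i I; rewrite AE => -[[x' g] Bp /= <-].
      by exists g.
    have [g gP] := choice gE.
    by exists (x, unslice g) => // i _; rewrite /f /= slice_unslice.
  by move=> [p Bp <-] i _; rewrite AE; exists (f i p) => //; exact: Bp.
case: n => [/(_ 0)//|[|n]] AS.
  have BE : forall i, exists B : set (X * baire_space),
      closed B /\ A i = fst @` B.
    by move=> i; have [B] := AS i; exists B.
  have [B BP] := choice BE.
  eexists; last by apply: E => i; exact: (BP i).2.
  apply: closed_bigI => i _; move/continuous_closedP : (fc i); apply.
  exact: (BP i).1.
have BE : forall i, exists B : set (X * baire_space),
    Sigma1 n.+1 (~` B) /\ A i = fst @` B.
  by move=> i; have [B] := AS i; exists B.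
have [B BP] := choice BE.
eexists; last by apply: E => i; exact: (BP i).2.
rewrite setC_bigcap; apply: Sigma1_bigcup => i; rewrite preimage_setC.
by apply: Sigma1_preimage => //; exact: (BP i).1.
Qed.

Lemma Sigma1_setI n (X : topologicalType) (A B : set X) :
  Sigma1 n A -> Sigma1 n B -> Sigma1 n (A `&` B).
Proof.
move=> AS BS; rewrite -bigcap2E; case: n AS BS => // n AS BS.
apply: Sigma1_bigcap => -[|[|i]] //=.
(* From index 2 on, the family is padded with the whole space. *)
exact: (@Sigma1_clopen n X _ (fun=> tt) setT (@locally_constant_cst _ _ tt)).
Qed.

(** * Countable bases and universal sets *)

Definition countable_base (X : topologicalType) (O : nat -> set X) :=
  (forall i, open (O i)) /\
  forall x U, nbhs x U -> exists2 i, O i x & O i `<=` U.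

Definition countably_based (X : topologicalType) :=
  exists O, @countable_base X O.

Lemma countably_based_prod (X Y : topologicalType) :
  countably_based X -> countably_based Y -> countably_based (X * Y)%type.
Proof.
move=> [O [oO bO]] [P [oP bP]].
pose c i : nat * nat := odflt (0, 0) (unpickle i).
exists (fun i => O (c i).1 `*` P (c i).2); split=> [i|[x y] U].
  rewrite openE => -[x y] [/= Ox Py]; exists (O (c i).1, P (c i).2) => //.
  by split; apply: open_nbhs_nbhs; split => /=.
move=> [[V W] [/= /bO[i Ox OV] /bP[j Py PW]] VW].
exists (pickle (i, j)); rewrite /c pickleK //= => -[x' y'] [/= ? ?].
by apply: VW; split; [exact: OV | exact: PW].
Qed.

(** The base consists of the cylinders given by finite sequences of values, transported to [nat] by
    [p]. *)
Lemma countably_based_product (T : discreteTopologicalType) (p : T -> nat) :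
  injective p -> countably_based (prod_topology (fun _ : nat => T)).
Proof.
move=> pinj; pose N := prod_topology (fun _ : nat => T).
pose q n (g : N) := mkseq (fun j => p (g j)) n.
have qE n (g h : N) j : q n g = q n h -> j < n -> g j = h j.
  by move=> /(congr1 (nth 0 ^~ j)) + jn; rewrite !nth_mkseq// => /pinj.
pose c i : seq nat := odflt [::] (unpickle i).
exists (fun i => q (size (c i)) @^-1` [set c i]); split=> [i|g U gU].
  apply: locally_constant_open; apply: locally_constant_mkseq => j x.
  have := @locally_constant_coord N T id j (fun _ => cvg_id) x.
  by apply: filterS => y ->.
(* The filter generated by the cylinders around [g]; its convergence to [g], checked coordinatewise,
   puts a cylinder inside every neighbourhood. *)
pose F := filter_from [set: nat] (fun n => [set h | q n h = q n g]).
have FF : Filter F.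
  apply: filter_from_filter; first by exists 0.
  move=> i j _ _; exists (maxn i j) => // h /= hg.
  by split; apply/(@eq_from_nth _ 0); rewrite ?size_mkseq// => k ki;
    rewrite !nth_mkseq//; congr p; apply: qE hg _; rewrite leq_max ki ?orbT.
have : F --> (g : N).
  apply/cvg_sup => i V nV; change (F V); move: nV.
  rewrite {1}nbhsE => -[_ [[B oB <-] /= Bg] sBV].
  exists i.+1 => // h /= hg; apply: sBV; rewrite /= (_ : h i = g i)//.
  exact: qE hg _.
move=> /(_ _ gU)[n _ nU]; exists (pickle (q n g)).
  by rewrite /c pickleK /= size_mkseq.
by rewrite /c pickleK /= size_mkseq; exact: nU.
Qed.

(** A closed set is coded by marking the basic open sets that miss it. At higher levels, one
    projects the complement of a universal set for the product with the Baire space. *)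
Lemma Sigma1_universal n (X : topologicalType) : countably_based X ->
  exists2 U : set (X * baire_space), Sigma1 n.+1 U &
    forall A, Sigma1 n.+1 A -> exists g, A = [set x | U (x, g)].
Proof.
have Ncb : countably_based baire_space.
  exact: (@countably_based_product nat id).
(* The parameter and the witness are exchanged, so that the projection removes the witness and keeps
   the parameter. *)
pose sw (Y : topologicalType) (p : (Y * baire_space) * baire_space) :=
  ((p.1.1, p.2), p.1.2).
have swc Y : continuous (sw Y).
  have c1 := @fst_continuous (Y * baire_space)%type baire_space.
  apply: pair_continuous; last exact: comp_continuous c1 (@snd_continuous _ _).
  apply: pair_continuous; last exact: snd_continuous.
  exact: comp_continuous c1 (@fst_continuous _ _).
have swE (Y : topologicalType) (V : set ((Y * baire_space) * baire_space)) g :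
    [set x | (fst @` (sw Y @^-1` V)) (x, g)] = fst @` [set p | V (p, g)].
  apply/seteqP; split=> x /=.
    by move=> [[[x' g'] h] /= Vx [<- <-]]; exists (x', h).
  by move=> [[x' h] /= Vx <-]; exists (x', g, h).
elim: n X => [|n IH] X Xcb.
  have [O [oO bO]] := countably_based_prod Xcb Ncb.
  pose F := \bigcap_i ((fun p : (X * baire_space) * baire_space => p.2 i) @^-1`
    [set 0] `|` fst @^-1` (~` O i)).
  exists (fst @` (sw X @^-1` F)).
    eexists; last reflexivity; move/continuous_closedP: (swc X); apply.
    apply: closed_bigI => i _; apply: closedU.
      apply: locally_constant_closed.
      exact: (@locally_constant_coord _ nat _ _ (@snd_continuous _ _)).
    have := @fst_continuous (X * baire_space)%type baire_space.
    move/continuous_closedP.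
    by apply; exact: open_closedC.
  (* Digit [i] of the parameter is 1 exactly when [O i] misses [C]. *)
  move=> A [C cC ->]; exists (fun i => `[< C `&` O i = set0 >] : nat).
  rewrite swE; congr (_ @` _); apply/seteqP; split=> p /=.
    move=> Cp i _ /=; case: asboolP => h; last by left.
    by right=> Op; have : (C `&` O i) p by []; rewrite h.
  move=> Fp; apply: contrapT => nCp.
  have [i Oip OiC] := bO p (~` C) (open_nbhs_nbhs (conj (closed_openC cC) nCp)).
  have [/=|//] := Fp i I; case: asboolP => // -[].
  by rewrite -subset0 => q [Cq /OiC].
have [V VS Vu] := IH _ (countably_based_prod Xcb Ncb).
exists (fst @` (sw X @^-1` (~` V))).
  eexists; last reflexivity; rewrite preimage_setC setCK.
  exact: Sigma1_preimage (swc X) VS.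
move=> A [B /Vu[g Bg] ->]; exists g; rewrite swE; congr (_ @` _).
by rewrite -[LHS]setCK Bg.
Qed.

(** * Copies along branches *)

(** The points of [nat] are read as codes of pairs (finite sequence, number);
    [graft g c] is the set of codes of [(s, m)] with [s] a prefix of [g] and
    [c m]. *)
Definition graft (g : nat -> nat) (c : nat -> bool) (a : nat) : bool :=
  if @unpickle (seq nat * nat)%type a is Some (s, m)
  then (s == mkseq g (size s)) && c m else false.

Definition label (a : nat) : nat :=
  if @unpickle (seq nat * nat)%type a is Some (_, m) then m else 0.

Definition code (s : seq nat) (m : nat) : nat := pickle (s, m).

Lemma graft_code g c s m :
  graft g c (code s m) = (s == mkseq g (size s)) && c m.
Proof. by rewrite /graft /code pickleK. Qed.

(** With [predT], the graft is the domain of the reduction, and every copy is the preimage of [c]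
    under [label] on that domain. *)
Lemma graftE g c a : graft g c a = graft g predT a && c (label a).
Proof. by rewrite /graft /label; case: unpickle => // -[s m]; rewrite andbT. Qed.

Lemma graft_infinite g : infinite_set [set a | graft g predT a].
Proof.
apply: (@sub_infinite_set _ (range (fun k => code (mkseq g k) 0))).
  by move=> _ [k _ <-]; rewrite /= graft_code size_mkseq eqxx.
rewrite (eq_finite_set (inj_card_eq _)); first exact: infinite_nat.
move=> i j _ _ /(pcan_inj pickleK)[/(congr1 size)].
by rewrite !size_mkseq.
Qed.

(** A branch other than [g] differs from it at some [j], hence on prefixes of length [j.+1]; the
    maximum over the finitely many indices works for all. *)
Lemma separating_length (g : nat -> nat) (h : nat -> nat -> nat) K :
  exists N, forall i, i < K -> mkseq g N = mkseq (h i) N -> h i = g.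
Proof.
have NE : forall i, exists N, mkseq g N = mkseq (h i) N -> h i = g.
  move=> i; have [->|hg] := EM (h i = g); first by exists 0.
  have [j hj] : exists j, h i j <> g j.
    apply: contrapT => /forallNP e; apply: hg; apply/funext => j.
    exact: contrapT.
  exists j.+1 => /(congr1 (nth 0 ^~ j)); rewrite !nth_mkseq// => e.
  by rewrite e in hj.
have [N NP] := choice NE; exists (\max_(i < K) N i) => i iK e.
apply: NP; have NiM := leq_bigmax (F := fun i : 'I_K => N i) (Ordinal iK).
move: e => /(congr1 (take (N i))).
by rewrite /mkseq -!map_take !take_iota; move/minn_idPl: NiM => /= ->.
Qed.

(** * The ideal generated by the copies, and its complexity *)

(** The covering families are infinite sequences, ready to be coded by points of the Baire space;
    only the entries below [K] count. *)
Definition graft_ideal (U : set (cantor_space * baire_space)) : set (set nat) :=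
  [set x | exists K (c : nat -> cantor_space) (g : nat -> baire_space),
     (forall i, i < K -> U (c i, g i)) /\
     (forall a, x a -> exists2 i, i < K & graft (g i) (c i) a)].

Lemma graft_ideal_is_ideal U : is_ideal (graft_ideal U).
Proof.
split.
- by exists set0, 0, (fun _ _ => false), (fun _ _ => 0); split.
- move=> x y [K [c [g [Ucg xP]]]] [L [d [h [Udh yP]]]].
  exists (K + L), (fun i => if i < K then c i else d (i - K)),
    (fun i => if i < K then g i else h (i - K)); split=> [i iKL|a].
    case: ltnP => [|Ki]; first exact: Ucg.
    by apply: Udh; rewrite ltn_subLR.
  case=> [/xP[i iK]|/yP[i iL]] ga.
    by exists i; [exact: ltn_addr | rewrite iK].
  exists (K + i); first by rewrite ltn_add2l.
  by rewrite ltnNge leq_addr /= addKn.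
- move=> x y yx [K [c [g [Ucg xP]]]]; exists K, c, g; split=> // a.
  by move=> /yx; exact: xP.
Qed.

(** Whether a fixed number lies in a graft depends on a finite prefix of the branch and at most one
    digit of the copied set. *)
Lemma graft_locally_constant (X : topologicalType)
    (g : X -> baire_space) (c : X -> cantor_space) a :
  continuous g -> continuous c ->
  locally_constant (fun x => graft (g x) (c x) a).
Proof.
move=> gc cc; rewrite /graft; case: unpickle => [[s m]|]; last first.
  exact: locally_constant_cst.
apply: (locally_constant_op andb); last first.
  exact: (@locally_constant_coord _ bool).
apply: (locally_constant_op (fun _ => eq_op s) (@locally_constant_cst _ _ tt)).
apply: (locally_constant_mkseq (f := fun i x => g x i)) => i.
exact: (@locally_constant_coord _ nat).
Qed.

(** A continuous surjection onto the Cantor space: projections run along the Baire space, while the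
    covering sets are points of the Cantor space. *)
Definition positive_digits (e : baire_space) : cantor_space := fun m => 0 < e m.

Lemma positive_digits_continuous : continuous positive_digits.
Proof.
apply: (@product_continuous _ (fun=> bool)) => m.
apply: locally_constant_continuous.
apply: (locally_constant_op (fun _ => leq 1) (@locally_constant_cst _ _ tt)).
exact: (@locally_constant_coord baire_space nat id m (fun _ => cvg_id)).
Qed.

(** The quantifiers over [K], [c] and [g] become three projections; what remains is a countable
    intersection of conditions, each clopen or inherited from [U]. *)
Lemma Sigma1_graft_ideal n U :
  Sigma1 n.+1 U -> Sigma1 n.+1 (char_family (graft_ideal U)).
Proof.
move=> US; pose Y := (((cantor_space * baire_space) * baire_space)
                      * baire_space)%type.
pose x (p : Y) := p.1.1.1; pose K (p : Y) : nat := p.1.1.2 0.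
pose c i (p : Y) := positive_digits (slice i p.1.2).
pose g i (p : Y) := slice i p.2.
pose f1 := @fst_continuous ((cantor_space * baire_space) * baire_space)%type
  baire_space.
pose f2 := comp_continuous f1 (@fst_continuous _ _).
have xc : continuous x := comp_continuous f2 (@fst_continuous _ _).
have kc : continuous (fun p : Y => p.1.1.2) :=
  comp_continuous f2 (@snd_continuous _ _).
have Kc : locally_constant K :=
  @locally_constant_coord Y nat _ 0 kc.
have cc i : continuous (c i).
  apply: comp_continuous (@positive_digits_continuous).
  exact: comp_continuous (comp_continuous f1 (@snd_continuous _ _))
    (@slice_continuous i).
have gc i : continuous (g i).
  exact: comp_continuous (@snd_continuous _ _) (@slice_continuous i).
pose A i := [set p : Y | i < K p -> U (c i p, g i p)].
pose B a := [set p : Y |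
  x p a ==> has id (mkseq (fun i => graft (g i p) (c i p) a) (K p))].
rewrite (_ : char_family _ =
    fst @` (fst @` (fst @` ((\bigcap_i A i) `&` (\bigcap_a B a))))); last first.
  apply/seteqP; split=> y /=.
    move=> [k [c0 [g0 [Ucg yP]]]].
    pose d := unslice (fun i m => c0 i m).
    have cE i : positive_digits (slice i d) = c0 i.
      by rewrite slice_unslice; apply/funext => m; exact: lt0b.
    exists (y, fun=> k) => //; exists (y, fun=> k, d) => //.
    exists (y, fun=> k, d, unslice g0) => //; split=> [i _|a _] /=.
      by rewrite /A /c /g /= cE slice_unslice; exact: Ucg.
    apply/implyP => /yP[i ik ga]; apply/hasP; exists true => //.
    by apply/mapP; exists i; rewrite ?mem_iota// /c /g /= cE slice_unslice.
  move=> [_ [_ [p [pA pB] <-] <-] <-].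
  exists (K p), (c^~ p), (g^~ p); split=> [i|a xa]; first exact: pA.
  have /implyP/(_ xa)/hasP[b /mapP[i]] := pB a I.
  by rewrite mem_iota /= => iK -> ?; exists i.
do 3!apply: Sigma1_proj; apply: Sigma1_setI; apply: Sigma1_bigcap => i.
  (* The implication is read as a selection by the truth value of [i < K p], with the whole space
     chosen when it fails. *)
  pose V b := if b is 0 then [set: Y] else (fun p => (c i p, g i p)) @^-1` U.
  rewrite (_ : A i = [set p | V (i < K p) p]); last first.
    by apply/seteqP; split=> p; rewrite /A /=; case: ltnP => // _; apply.
  apply: (@Sigma1_select _ _ (fun p => nat_of_bool (i < K p))).
    exact: (locally_constant_op (fun _ k => nat_of_bool (i < k))
              (@locally_constant_cst _ _ tt) Kc).
  case=> [|b]; last by apply: Sigma1_preimage US; exact: pair_continuous.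
  exact: (@Sigma1_clopen _ _ _ (fun=> tt) setT (@locally_constant_cst _ _ tt)).
apply: (@Sigma1_clopen _ _ _ (fun p : Y => x p i ==> has id
  (mkseq (fun j => graft (g j p) (c j p) i) (K p))) [set b | is_true b]).
apply: (locally_constant_op implb).
  exact: (@locally_constant_coord Y bool x _ xc).
apply: (@locally_constant_select _ _ _ K
  (fun k p => has id (mkseq (fun i => graft (g i p) (c i p) _) k))) => // k.
apply: (locally_constant_op (fun _ => has id) (@locally_constant_cst _ _ tt)).
apply: (locally_constant_mkseq (f := fun j p => graft (g j p) (c j p) _)) => j.
exact: graft_locally_constant.
Qed.

(** * The reduction and the complete ideal *)

Lemma wRK_le_graft_ideal U I g :
  is_ideal I -> char_family I = [set x | U (x, g)] -> wRK_le I (graft_ideal U).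
Proof.
move=> [[x0 Ix0] IU Isub] IE.
have UI (c : cantor_space) : U (c, g) <-> I [set i | c i].
  by have := congr1 (@^~ c) IE; rewrite /char_family /= => ->.
have I0 : I set0 by exact: Isub Ix0.
exists [set a | graft g predT a], (fun a => label (set_val a)).
split; first exact: graft_infinite.
move=> x; rewrite (_ : set_val @` _ =
    [set a | graft g (fun m => `[< x m >]) a]); last first.
  apply/seteqP; split=> a /=.
    move=> [[b /= bA] xb <-]; rewrite graftE; apply/andP; split.
      exact: set_mem bA.
    exact/asboolP.
  rewrite graftE => /andP[ga /asboolP xa].
  by exists (exist _ a (mem_set ga)).
split=> [Ix|[K [c [h [Uch xP]]]]].
  exists 1, (fun _ m => `[< x m >]), (fun=> g); split=> [i _|a ga].
    by apply/UI; apply: Isub Ix => m /= /asboolP.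
  by exists 0.
have [N NP] := separating_length g h K.
(* Only the covering sets carried by the branch [g] itself are joined; they belong to [I], and the
   empty set handles the case where there are none. *)
have IK k : k <= K -> I [set m | exists i, [/\ i < k, h i = g & c i m]].
  elim: k => [_|k IH kK]; first by apply: Isub I0 => m [i []].
  have [hg|hg] := EM (h k = g); last first.
    apply: Isub (IH (ltnW kK)) => m [i [ik hi ci]]; exists i; split=> //.
    by move: ik; rewrite ltnS leq_eqVlt => /predU1P[ik|//]; rewrite ik in hi.
  have ck : I [set m | c k m] by apply/UI; rewrite -hg; exact: Uch.
  apply: Isub (IU _ _ (IH (ltnW kK)) ck) => m [i [ik hi ci]].
  move: ik; rewrite ltnS leq_eqVlt => /predU1P[ik|ik]; last by left; exists i.
  by right; rewrite /= -ik.
(* For [m] in [x], the copy of [m] at the prefix of length [N] is covered by some graft; its branch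
   shares that prefix, hence equals [g]. *)
apply: Isub (IK K (leqnn K)) => m xm.
have /xP[i iK] : graft g (fun m => `[< x m >]) (code (mkseq g N) m).
  by rewrite graft_code size_mkseq eqxx; exact/asboolP.
rewrite graft_code size_mkseq => /andP[/eqP/(NP i iK) hi ci].
by exists i.
Qed.

Theorem theorem1p3 (n : nat) (hn : 1 <= n) :
  exists J : set (set nat), wRK_complete (Sigma1_ideals n) J.
Proof.
case: n hn => // n _.
have [|U US Uu] := @Sigma1_universal n cantor_space.
  by apply: (@countably_based_product bool nat_of_bool) => -[] [].
exists (graft_ideal U); split.
  by split; [exact: graft_ideal_is_ideal | exact: Sigma1_graft_ideal].
move=> I [Iid /Uu[g IE]]; exact: wRK_le_graft_ideal Iid IE.
Qed.
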